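(* Let $F_n$ be the free group of finite rank $n$ and let $H$ be a finitely generated subgroup of $F_n$. Then the set $\mathrm{Coc}_{\vee}(H)$ of $\vee$-cocycles of $H$ is rational, and one can effectively compute (from a finite generating set of $H$) a finite automaton recognizing it.
   Context: $F_n$ is the free group with basis $A=\{a_1,\dots,a_n\}$; its elements are identified with freely reduced words over $A^{\pm}=A\sqcup A^{-1}$. For $H\leqslant F_n$, $\mathrm{Coc}_{\vee}(H)=\{u\in F_n : \langle H\cup\{u\}\rangle=F_n\}$. A subset of $F_n$ is rational if the set of reduced words representing its elements is a rational (regular) language over $A^{\pm}$ (by Benois' theorem this agrees with the usual notion of rational subset of the group $F_n$). *)

(* Defs.v *)
From HB Require Import structures.
From mathcomp Require Import all_boot.
From mathcomp Require Import boolp classical_sets functions cardinality.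

Set Implicit Arguments.
Unset Strict Implicit.
Unset Printing Implicit Defensive.

Local Open Scope classical_set_scope.
Local Open Scope group_scope.

(* (i, true) stands for a_i and (i, false) for its formal inverse. *)
Definition letter (n : nat) : Type := ('I_n * bool)%type.

HB.instance Definition _ (n : nat) := Finite.on (letter n).

Section FreeGroup.
Variable n : nat.
Implicit Types (a b : letter n) (u v w : seq (letter n)).

Definition inv_letter a : letter n := (a.1, ~~ a.2).

Definition reduced w : bool := sorted (fun a b => b != inv_letter a) w.

Definition push a w :=
  if w is b :: w' then if b == inv_letter a then w' else a :: w else [:: a].

Definition free_reduce w := foldr push [::] w.

Lemma inv_letterK : involutive inv_letter.
Proof. by case=> i b; rewrite /inv_letter /= negbK. Qed.

Lemma push_reduced a w : reduced w -> reduced (push a w).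
Proof.
case: w => [//|b w]; rewrite /reduced /=.
by case: eqVneq => [_ /path_sorted //|ba /= ->]; rewrite ba.
Qed.

Lemma free_reduce_reduced w : reduced (free_reduce w).
Proof. by elim: w => //= a w; apply: push_reduced. Qed.

Lemma free_reduce_id w : reduced w -> free_reduce w = w.
Proof.
elim: w => //= a w IH aw; rewrite IH; last exact: path_sorted aw.
by case: w aw {IH} => //= b w /andP[/negPf ->].
Qed.

Lemma pushK a w : reduced w -> push a (push (inv_letter a) w) = w.
Proof.
case: w => [|b w] /=; first by rewrite eqxx.
rewrite inv_letterK; case: eqVneq => [->|_] bw /=; last by rewrite eqxx.
by case: w bw => //= c w /andP[/negPf ->].
Qed.

Lemma foldr_push_reduced u v : reduced v -> reduced (foldr push v u).
Proof. by move=> rv; elim: u => //= a u; apply: push_reduced. Qed.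

Lemma foldr_push a u v : reduced v ->
  foldr push v (push a u) = push a (foldr push v u).
Proof.
case: u => //= b u rv; case: eqVneq => //= ->.
by rewrite pushK //; apply: foldr_push_reduced.
Qed.

Lemma foldr_push_free_reduce u v : reduced v ->
  foldr push v (free_reduce u) = foldr push v u.
Proof. by move=> rv; elim: u => //= a u IH; rewrite foldr_push // IH. Qed.

Lemma free_reduce_catl u v :
  free_reduce (free_reduce u ++ v) = free_reduce (u ++ v).
Proof.
rewrite /free_reduce !foldr_cat.
exact: (foldr_push_free_reduce u (free_reduce_reduced v)).
Qed.

Lemma free_reduce_catr u v :
  free_reduce (u ++ free_reduce v) = free_reduce (u ++ v).
Proof.
rewrite {1 3}/free_reduce !foldr_cat.
by rewrite -/(free_reduce _) (free_reduce_id (free_reduce_reduced v)).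
Qed.

Definition inv_word w := rev (map inv_letter w).

Lemma inv_wordK : involutive inv_word.
Proof.
by move=> w; rewrite /inv_word map_rev revK -map_comp map_id_in //= => a _;
  apply: inv_letterK.
Qed.

Lemma inv_word_reduced w : reduced w -> reduced (inv_word w).
Proof.
rewrite /reduced /inv_word rev_sorted sorted_map; apply: sub_sorted => a b /=.
by apply: contra => /eqP ->; rewrite !inv_letterK.
Qed.

Lemma free_reduce_cat_inv w : free_reduce (w ++ inv_word w) = [::].
Proof.
suff H v : reduced v -> foldr push (foldr push v (inv_word w)) w = v.
  by rewrite /free_reduce foldr_cat H.
elim: w v => //= a w IH v rv.
rewrite /inv_word /= rev_cons foldr_rcons IH ?pushK //.
exact: push_reduced.
Qed.

Record free_group : Type :=
  FreeGroup { word : seq (letter n); _ : reduced word }.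

HB.instance Definition _ := [isSub for word].
HB.instance Definition _ := [Choice of free_group by <:].

Definition fg_one : free_group := FreeGroup (isT : reduced [::]).

Definition fg_mul (x y : free_group) : free_group :=
  FreeGroup (free_reduce_reduced (word x ++ word y)).

Definition fg_inv (x : free_group) : free_group :=
  FreeGroup (inv_word_reduced (valP x)).

Lemma fg_mulA : associative fg_mul.
Proof.
by move=> x y z; apply: val_inj => /=; rewrite free_reduce_catr
  free_reduce_catl catA.
Qed.

Lemma fg_mul1g : left_id fg_one fg_mul.
Proof. by move=> x; apply: val_inj; apply: free_reduce_id (valP x). Qed.

Lemma fg_mulg1 : right_id fg_one fg_mul.
Proof.
by move=> x; apply: val_inj; rewrite /= cats0; apply: free_reduce_id (valP x).
Qed.

Lemma fg_mulgV : right_inverse fg_one fg_inv fg_mul.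
Proof. by move=> x; apply: val_inj; apply: free_reduce_cat_inv. Qed.

Lemma fg_mulVg : left_inverse fg_one fg_inv fg_mul.
Proof.
move=> x; apply: val_inj => /=; rewrite -{2}(inv_wordK (word x)).
exact: free_reduce_cat_inv.
Qed.

HB.instance Definition _ :=
  isGroup.Build free_group fg_mulA fg_mul1g fg_mulg1 fg_mulVg fg_mulgV.

End FreeGroup.

Section Subgroups.
Variable G : groupType.
Implicit Types H S : set G.

Definition subgroup H : Prop := H 1 /\ (forall x y, H x -> H y -> H (x / y)).

Definition generated S : set G := smallest subgroup S.

Definition finitely_generated H : Prop :=
  exists2 S : set G, finite_set S & H = generated S.

Definition coc_join H : set G :=
  [set u | generated (H `|` [set u]) = [set: G]].

End Subgroups.

(* A nondeterministic finite automaton over A, presented by finite data: an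
   edge (p, a, q) is an a-transition from p to q, and the states are the
   finitely many naturals occurring in the three lists. *)
Record automaton (A : Type) : Type := Automaton {
  initial : seq nat;
  final : seq nat;
  edges : seq (nat * A * nat)
}.

Section Automata.
Variable A : eqType.
Implicit Types (M : automaton A) (w : seq A).

Fixpoint run M (p : nat) w (q : nat) : bool :=
  if w is a :: w' then
    has (fun e => [&& e.1.1 == p, e.1.2 == a & run M e.2 w' q]) (edges M)
  else p == q.

Definition accepts M w : bool :=
  has (fun p => has (run M p w) (final M)) (initial M).

Definition recognizes M (L : set (seq A)) : Prop :=
  L = [set w | accepts M w].

Definition regular (L : set (seq A)) : Prop :=
  exists M : automaton A, recognizes M L.

End Automata.

Definition language (n : nat) (S : set (free_group n)) : set (seq (letter n)) :=
  [set word x | x in S].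

Definition rational (n : nat) (S : set (free_group n)) : Prop :=
  regular (language S).

(* Model of computation: while-programs acting on a single variable X that
   holds a binary tree.  This is the Turing-complete language I of N. D. Jones
   (Computability and Complexity from a Programming Perspective), that is, his
   language WHILE restricted to one variable and one atom. *)
Inductive tree : Type := Nil | Cons of tree & tree.

Inductive expr : Type :=
  | EVar
  | ENil
  | ECons of expr & expr
  | EHd of expr
  | ETl of expr.

Inductive cmd : Type :=
  | CAssign of expr
  | CSeq of cmd & cmd
  | CWhile of expr & cmd.

Definition hd (t : tree) : tree := if t is Cons l _ then l else Nil.
Definition tl (t : tree) : tree := if t is Cons _ r then r else Nil.

Fixpoint eval (e : expr) (x : tree) : tree :=
  match e with
  | EVar => x
  | ENil => Nil
  | ECons e1 e2 => Cons (eval e1 x) (eval e2 x)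
  | EHd e1 => hd (eval e1 x)
  | ETl e1 => tl (eval e1 x)
  end.

(* exec c x y: started with X = x, the command c terminates with X = y. *)
Inductive exec : cmd -> tree -> tree -> Prop :=
  | ExecAssign e x : exec (CAssign e) x (eval e x)
  | ExecSeq c1 c2 x y z :
      exec c1 x y -> exec c2 y z -> exec (CSeq c1 c2) x z
  | ExecWhileStop e c x : eval e x = Nil -> exec (CWhile e c) x x
  | ExecWhileStep e c x y z : eval e x <> Nil ->
      exec c x y -> exec (CWhile e c) y z -> exec (CWhile e c) x z.

(* Naturals are encoded in unary, lists as right-nested Cons ended by Nil. *)
Definition enc_bool (b : bool) : tree := if b then Cons Nil Nil else Nil.

Definition enc_nat (m : nat) : tree := iter m (Cons Nil) Nil.

Definition enc_seq (T : Type) (enc : T -> tree) (s : seq T) : tree :=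
  foldr (fun x t => Cons (enc x) t) Nil s.

Definition enc_letter (n : nat) (a : letter n) : tree :=
  Cons (enc_nat a.1) (enc_bool a.2).

Definition enc_edge (n : nat) (e : nat * letter n * nat) : tree :=
  Cons (enc_nat e.1.1) (Cons (enc_letter e.1.2) (enc_nat e.2)).

Definition enc_automaton (n : nat) (M : automaton (letter n)) : tree :=
  Cons (enc_seq enc_nat (initial M))
    (Cons (enc_seq enc_nat (final M)) (enc_seq (@enc_edge n) (edges M))).

(* The rank n together with a finite list of elements of F_n, given as reduced
   words. *)
Definition enc_generators (n : nat) (gens : seq (free_group n)) : tree :=
  Cons (enc_nat n)
    (enc_seq (fun x : free_group n => enc_seq (@enc_letter n) (word x)) gens).

(* Main.v *)
Require Import Defs.
From mathcomp Require Import all_boot zify.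
From mathcomp Require Import boolp classical_sets functions cardinality.
Import Defs.

(* Folding the bouquet of the generators gives the Stallings graph G of H, and
   w is in H exactly when w can be read along a closed path of G at the base
   point.  For u <> 1, the subgroup <H, u> is the whole group iff one letter of
   u can be singled out, u = w1 a w2, such that G reads w1 from the base point
   to some p and w2 from some q to the base point, and G with an extra edge from
   p to q labelled a folds to the full bouquet.  Indeed, otherwise the part of u
   that G reads from neither side has at least two letters; glued to G it
   creates a vertex that survives folding.  The finitely many good triples
   (p, a, q) are found by folding, and the automaton is made of two copies of G
   joined by these triples, restricted to reduced words. *)

Set Implicit Arguments.
Unset Strict Implicit.
Unset Printing Implicit Defensive.

(** * Computable functions on encoded data *)

(** Fullness of a folded graph is tied to [<S> = F_n] by two one-sided tests. A potential on the
    vertices, preserved by folding, shows that closed paths at 0 read only elements of the subgroup.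
    Conversely, the elements read along closed paths at 0 in any symmetric deterministic graph form
    a subgroup, so such a graph bounds [<S>] from above once it reads [S]. The second test also
    accepts graphs that no program builds, which is why the gluing uses a propositional edge
    relation and classical logic. The effective half asks for one concrete program in a language
    with a single tree variable; computability is therefore propagated through combinators instead
    of writing that program out. *)

Class Enc (T : Type) := enc : T -> tree.
#[export] Hint Mode Enc ! : typeclass_instances.
#[export] Instance enc_unit_inst : Enc unit := fun _ => Nil.
#[export] Instance enc_bool_inst : Enc bool := enc_bool.
#[export] Instance enc_nat_inst : Enc nat := enc_nat.
#[export] Instance enc_prod_inst (A B : Type) {_ : Enc A} {_ : Enc B} :
  Enc (A * B) := fun x => Cons (enc x.1) (enc x.2).
#[export] Instance enc_seq_inst (A : Type) {_ : Enc A} : Enc (seq A) :=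
  enc_seq enc.

Definition computable (A B : Type) {_ : Enc A} {_ : Enc B} (f : A -> B) :
    Prop :=
  exists c, forall a, exec c (enc a) (enc (f a)).

(* [lift_cmd c] runs [c] on the head of the variable and preserves the tail. *)
Fixpoint lift_expr (e : expr) : expr :=
  match e with
  | EVar => EHd EVar
  | ENil => ENil
  | ECons e1 e2 => ECons (lift_expr e1) (lift_expr e2)
  | EHd e1 => EHd (lift_expr e1)
  | ETl e1 => ETl (lift_expr e1)
  end.

Fixpoint lift_cmd (c : cmd) : cmd :=
  match c with
  | CAssign e => CAssign (ECons (lift_expr e) (ETl EVar))
  | CSeq c1 c2 => CSeq (lift_cmd c1) (lift_cmd c2)
  | CWhile e c1 => CWhile (lift_expr e) (lift_cmd c1)
  end.

Lemma eval_lift e x r : eval (lift_expr e) (Cons x r) = eval e x.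
Proof. by elim: e => //= [e1 -> e2 ->|e ->|e ->]. Qed.

Lemma exec_assign e x y : eval e x = y -> exec (CAssign e) x y.
Proof. by move=> <-; constructor. Qed.

Lemma exec_lift c x y r : exec c x y -> exec (lift_cmd c) (Cons x r) (Cons y r).
Proof.
elim=> {c x y} /= [e x|c1 c2 x y z _ IH1 _ IH2|e c x ex
  |e c x y z ex _ IH1 _ IH2].
- by apply: exec_assign; rewrite /= eval_lift.
- exact: ExecSeq IH1 IH2.
- by apply: ExecWhileStop; rewrite eval_lift.
- by apply: ExecWhileStep IH1 IH2; rewrite eval_lift.
Qed.

Lemma computable_expr (A B : Type) {eA : Enc A} {eB : Enc B} e (f : A -> B) :
  (forall a, eval e (enc a) = enc (f a)) -> computable f.
Proof. by move=> ef; exists (CAssign e) => a; apply: exec_assign. Qed.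

Section Basic.
Context {A B C : Type} {eA : Enc A} {eB : Enc B} {eC : Enc C}.

Lemma computable_ext (f g : A -> B) : f =1 g -> computable f -> computable g.
Proof. by move=> fg [c cf]; exists c => a; rewrite -fg. Qed.

Lemma computable_id : computable (fun a : A => a).
Proof. exact: (computable_expr (e := EVar)). Qed.

Lemma computable_comp (g : B -> C) (f : A -> B) :
  computable g -> computable f -> computable (fun a => g (f a)).
Proof.
by move=> [cg Hg] [cf Hf]; exists (CSeq cf cg) => a; apply: ExecSeq (Hf a) _.
Qed.

(** With a single variable, the input is duplicated: one copy is processed by a lifted program while
    the other waits in the tail. *)
Lemma computable_pair (f : A -> B) (g : A -> C) :
  computable f -> computable g -> computable (fun a => (f a, g a)).
Proof.
move=> [cf Hf] [cg Hg].
pose swap := CAssign (ECons (ETl EVar) (EHd EVar)).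
exists (CSeq (CAssign (ECons EVar EVar))
  (CSeq (lift_cmd cf) (CSeq swap (CSeq (lift_cmd cg) swap)))) => a.
apply: (@ExecSeq _ _ _ (Cons (enc a) (enc a))); first exact: exec_assign.
apply: ExecSeq (exec_lift _ (Hf a)) _.
apply: (@ExecSeq _ _ _ (Cons (enc a) (enc (f a)))); first exact: exec_assign.
apply: ExecSeq (exec_lift _ (Hg a)) _.
exact: exec_assign.
Qed.

End Basic.

Section Projections.
Context {A B C : Type} {eA : Enc A} {eB : Enc B} {eC : Enc C}.

Lemma computable_fst (f : A -> B * C) :
  computable f -> computable (fun a => (f a).1).
Proof.
apply: (computable_comp (g := fst)).
exact: (computable_expr (e := EHd EVar)).
Qed.

Lemma computable_snd (f : A -> B * C) :
  computable f -> computable (fun a => (f a).2).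
Proof.
apply: (computable_comp (g := snd)).
exact: (computable_expr (e := ETl EVar)).
Qed.

Lemma computable_cons (f : A -> B) (s : A -> seq B) :
  computable f -> computable s -> computable (fun a => f a :: s a).
Proof.
move=> cf cs; apply: (computable_comp (f := fun a => (f a, s a))
  (g := fun z => z.1 :: z.2)); last exact: computable_pair.
(* A pair of head and tail has the same tree as the list they form, so the program is the
   identity. *)
exact: (computable_expr (e := EVar)).
Qed.

End Projections.

Lemma computable_const (A B : Type) {eA : Enc A} {eB : Enc B} (b : B) :
  computable (fun _ : A => b).
Proof.
pose quote := fix q t := if t is Cons l r then ECons (q l) (q r) else ENil.
apply: (computable_expr (e := quote (enc b))) => a.
by elim: (enc b) => //= l -> r ->.
Qed.

(** The basic loop scheme: all further recursion on data is reduced to it, up to changes of type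
    that keep the tree. *)
Lemma computable_foldl (X A B : Type) {eX : Enc X} {eA : Enc A} {eB : Enc B}
    (f : X -> B -> A -> B) (z : X -> B) (s : X -> seq A) :
  computable (fun y : X * (B * A) => f y.1 y.2.1 y.2.2) ->
  computable z -> computable s ->
  computable (fun x => foldl (f x) (z x) (s x)).
Proof.
move=> [c Hc] cz cs.
pose g := fun x : X * (B * seq A) => foldl (f x.1) x.2.1 x.2.2.
have ci : computable (fun x => (x, (z x, s x))).
  by do 2?[apply: computable_pair => //]; apply: computable_id.
apply: (computable_comp (g := g) _ ci) => {ci cz cs}.
pose x := EHd EVar; pose l := ETl (ETl EVar).
(* The loop state is [(x, (accumulator, rest))]. [prep] puts the argument of [c] in the head and
   saves [(x, rest)] in the tail; [done_] rebuilds the state. *)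
pose prep := CAssign (ECons (ECons x (ECons (EHd (ETl EVar)) (EHd l)))
  (ECons x (ETl l))).
pose done_ := CAssign (ECons (EHd (ETl EVar))
  (ECons (EHd EVar) (ETl (ETl EVar)))).
exists (CSeq (CWhile l (CSeq prep (CSeq (lift_cmd c) done_)))
  (CAssign (EHd (ETl EVar)))).
case=> a [b r]; rewrite /g /=.
apply: (@ExecSeq _ _ _ (enc (a, (foldl (f a) b r, [::] : seq A)))); last first.
  exact: exec_assign.
elim: r b => [|h r IH] b; first exact: ExecWhileStop.
apply: ExecWhileStep (IH (f a b h)) => //.
apply: (@ExecSeq _ _ _ (enc ((a, (b, h)), (a, r)))); first exact: exec_assign.
apply: ExecSeq (exec_lift _ (Hc (a, (b, h)))) _.
exact: exec_assign.
Qed.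

Ltac comp_basic :=
  first
  [ assumption
  | lazymatch goal with
    | |- computable (fun _ => ?b) => exact: computable_const
    | |- computable (fun x => x) => exact: computable_id
    | |- computable (fun _ => fst _) => apply: computable_fst; comp_basic
    | |- computable (fun _ => snd _) => apply: computable_snd; comp_basic
    | |- computable fst => exact: (computable_fst computable_id)
    | |- computable snd => exact: (computable_snd computable_id)
    | |- computable (fun _ => (_, _)) => apply: computable_pair; comp_basic
    | |- computable (fun _ => _ :: _) => apply: computable_cons; comp_basic
    end
  | idtac ].

Lemma computable_rev (X A : Type) {eX : Enc X} {eA : Enc A} (s : X -> seq A) :
  computable s -> computable (fun x => rev (s x)).
Proof.
move=> cs; apply: (computable_ext (f := fun x =>
  foldl (fun r a => a :: r) [::] (s x))).
  move=> x; rewrite -{1}[s x]revK foldl_rev.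
  by elim: (rev _) => //= a r ->.
by apply: (computable_foldl (f := fun _ r a => a :: r)); comp_basic.
Qed.

Lemma computable_foldr (X A B : Type) {eX : Enc X} {eA : Enc A} {eB : Enc B}
    (f : X -> A -> B -> B) (z : X -> B) (s : X -> seq A) :
  computable (fun y : X * (B * A) => f y.1 y.2.2 y.2.1) ->
  computable z -> computable s ->
  computable (fun x => foldr (f x) (z x) (s x)).
Proof.
move=> cf cz cs; apply: (computable_ext (f := fun x =>
  foldl (fun b a => f x a b) (z x) (rev (s x)))).
  by move=> x; rewrite foldl_rev.
apply: (computable_foldl (f := fun x b a => f x a b)) => //.
exact: computable_rev.
Qed.

Lemma computable_if (X A : Type) {eX : Enc X} {eA : Enc A}
    (b : X -> bool) (f g : X -> A) :
  computable b -> computable f -> computable g ->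
  computable (fun x => if b x then f x else g x).
Proof.
move=> cb cf cg; apply: (computable_ext (f := fun x =>
  foldl (fun _ _ => f x) (g x) (nseq (b x) tt))).
  by move=> x; case: (b x).
apply: (computable_foldl (f := fun x _ _ => f x)) => //.
  by apply: (computable_comp (f := fst) cf); comp_basic.
apply: (computable_comp (g := fun b0 : bool => nseq b0 tt)) cb.
(* A boolean and a list of at most one [tt] share their tree, so the conditional is a loop of at
   most one round. *)
by apply: (computable_expr (e := EVar)); case.
Qed.

Lemma computable_iter (X A : Type) {eX : Enc X} {eA : Enc A}
    (m : X -> nat) (f : X -> A -> A) (z : X -> A) :
  computable m -> computable (fun y : X * A => f y.1 y.2) -> computable z ->
  computable (fun x => iter (m x) (f x) (z x)).
Proof.
move=> cm cf cz; apply: (computable_ext (f := fun x =>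
  foldr (fun _ a => f x a) (z x) (nseq (m x) tt))).
  by move=> x; elim: (m x) => //= k ->.
apply: (computable_foldr (f := fun x _ a => f x a)) => //.
  by apply: (computable_comp (f := fun y => (y.1, y.2.1)) cf); comp_basic.
apply: (computable_comp (g := fun k : nat => nseq k tt)) cm.
(* In unary, [k] is the same tree as a list of [k] units. *)
apply: (computable_expr (e := EVar)); elim=> // k IH.
exact: (congr1 (Cons Nil) IH).
Qed.

Lemma computable_map (X A B : Type) {eX : Enc X} {eA : Enc A} {eB : Enc B}
    (f : X -> A -> B) (s : X -> seq A) :
  computable (fun y : X * A => f y.1 y.2) -> computable s ->
  computable (fun x => [seq f x a | a <- s x]).
Proof.
move=> cf cs.
apply: (computable_ext (f := fun x =>
  foldr (fun a r => f x a :: r) [::] (s x))).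
  by move=> x; elim: (s x) => //= a r ->.
apply: (computable_foldr (f := fun x a r => f x a :: r)); comp_basic.
by apply: (computable_comp (f := fun y => (y.1, y.2.2)) cf); comp_basic.
Qed.

Lemma computable_filter (X A : Type) {eX : Enc X} {eA : Enc A}
    (p : X -> A -> bool) (s : X -> seq A) :
  computable (fun y : X * A => p y.1 y.2) -> computable s ->
  computable (fun x => [seq a <- s x | p x a]).
Proof.
move=> cp cs; apply: (computable_ext (f := fun x =>
  foldr (fun a r => if p x a then a :: r else r) [::] (s x))).
  by move=> x; elim: (s x) => //= a r ->.
apply: (computable_foldr (f := fun x a r => if p x a then a :: r else r));
  comp_basic.
apply: computable_if; comp_basic.
by apply: (computable_comp (f := fun y => (y.1, y.2.2)) cp); comp_basic.
Qed.

Lemma computable_all (X A : Type) {eX : Enc X} {eA : Enc A}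
    (p : X -> A -> bool) (s : X -> seq A) :
  computable (fun y : X * A => p y.1 y.2) -> computable s ->
  computable (fun x => all (p x) (s x)).
Proof.
move=> cp cs; apply: (computable_ext (f := fun x =>
  foldr (fun a b => if p x a then b else false) true (s x))).
  by move=> x; elim: (s x) => //= a r ->; case: p.
apply: (computable_foldr (f := fun x a b => if p x a then b else false));
  comp_basic.
  apply: computable_if; comp_basic.
  by apply: (computable_comp (f := fun y => (y.1, y.2.2)) cp); comp_basic.
Qed.

Lemma computable_has (X A : Type) {eX : Enc X} {eA : Enc A}
    (p : X -> A -> bool) (s : X -> seq A) :
  computable (fun y : X * A => p y.1 y.2) -> computable s ->
  computable (fun x => has (p x) (s x)).
Proof.
move=> cp cs; apply: (computable_ext (f := fun x =>
  foldr (fun a b => if p x a then true else b) false (s x))).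
  by move=> x; elim: (s x) => //= a r ->; case: p.
apply: (computable_foldr (f := fun x a b => if p x a then true else b));
  comp_basic.
  apply: computable_if; comp_basic.
  by apply: (computable_comp (f := fun y => (y.1, y.2.2)) cp); comp_basic.
Qed.

Lemma computable_cat (X A : Type) {eX : Enc X} {eA : Enc A}
    (s t : X -> seq A) :
  computable s -> computable t -> computable (fun x => s x ++ t x).
Proof.
move=> cs ct; apply: (computable_ext (f := fun x => foldr cons (t x) (s x))).
  by move=> x; elim: (s x) => //= a r ->.
by apply: (computable_foldr (f := fun _ => cons)); comp_basic.
Qed.

Lemma computable_flatten (X A : Type) {eX : Enc X} {eA : Enc A}
    (s : X -> seq (seq A)) :
  computable s -> computable (fun x => flatten (s x)).
Proof.
move=> cs; apply: (computable_foldr (f := fun _ => cat)); comp_basic.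
by apply: computable_cat; comp_basic.
Qed.

Lemma computable_head (X A : Type) {eX : Enc X} {eA : Enc A}
    (a : X -> A) (s : X -> seq A) :
  computable a -> computable s -> computable (fun x => head (a x) (s x)).
Proof.
move=> ca cs; apply: (computable_ext (f := fun x =>
  foldr (fun b _ => b) (a x) (s x))); first by move=> x; case: (s x).
by apply: (computable_foldr (f := fun _ b _ => b)); comp_basic.
Qed.

Lemma computable_size (X A : Type) {eX : Enc X} {eA : Enc A}
    (s : X -> seq A) :
  computable s -> computable (fun x => size (s x)).
Proof.
move=> cs; apply: (computable_comp (g := fun r : seq A => size r)) cs.
apply: (computable_ext (f := foldr (fun _ k => k.+1) 0)) => //.
apply: (computable_foldr (f := fun _ _ k => k.+1)); comp_basic.
  by apply: (computable_expr (e := ECons ENil (EHd (ETl EVar)))).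
Qed.

Lemma computable_allpairs (X A B : Type) {eX : Enc X} {eA : Enc A} {eB : Enc B}
    (s : X -> seq A) (t : X -> seq B) :
  computable s -> computable t ->
  computable (fun x => [seq (a, b) | a <- s x, b <- t x]).
Proof.
move=> cs ct; apply: computable_flatten.
apply: (computable_map (f := fun x a => [seq (a, b) | b <- t x])) => //.
apply: (computable_map (f := fun y b => (y.2, b))); comp_basic.
by apply: (computable_comp ct); comp_basic.
Qed.

Lemma computable_succ (X : Type) {eX : Enc X} (f : X -> nat) :
  computable f -> computable (fun x => (f x).+1).
Proof.
apply: (computable_comp (g := S)).
exact: (computable_expr (e := ECons ENil EVar)).
Qed.

Lemma computable_pred (X : Type) {eX : Enc X} (f : X -> nat) :
  computable f -> computable (fun x => (f x).-1).
Proof.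
apply: (computable_comp (g := predn)).
by apply: (computable_expr (e := ETl EVar)); case.
Qed.

Lemma computable_add (X : Type) {eX : Enc X} (f g : X -> nat) :
  computable f -> computable g -> computable (fun x => f x + g x).
Proof.
move=> cf cg; apply: (computable_ext (f := fun x => iter (f x) S (g x))).
  by move=> x; rewrite iter_succn addnC.
by apply: (computable_iter (f := fun _ => S)) => //; apply: computable_succ;
  comp_basic.
Qed.

Lemma computable_mul (X : Type) {eX : Enc X} (f g : X -> nat) :
  computable f -> computable g -> computable (fun x => f x * g x).
Proof.
move=> cf cg; apply: (computable_ext (f := fun x => iter (f x) (addn (g x)) 0)).
  by move=> x; rewrite iter_addn_0 mulnC.
apply: (computable_iter (f := fun x => addn (g x))); comp_basic.
  apply: computable_add; comp_basic.
  by apply: (computable_comp cg); comp_basic.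
Qed.

Lemma computable_eq0 (X : Type) {eX : Enc X} (f : X -> nat) :
  computable f -> 
  computable (fun x => f x == 0).
Proof.
move=> cf; apply: (computable_ext (f := fun x =>
  iter (f x) (fun _ => false) true)); first by move=> x; case: (f x).
by apply: (computable_iter (f := fun _ _ => false)) => //;
  apply: computable_const.
Qed.

Lemma computable_subn (X : Type) {eX : Enc X} (f g : X -> nat) :
  computable f -> computable g -> computable (fun x => f x - g x).
Proof.
move=> cf cg; apply: (computable_ext (f := fun x => iter (g x) predn (f x))).
  by move=> x; rewrite iter_predn.
by apply: (computable_iter (f := fun _ => predn)) => //; apply: computable_pred;
  comp_basic.
Qed.

Lemma computable_and (X : Type) {eX : Enc X} (b c : X -> bool) :
  computable b -> computable c -> computable (fun x => b x && c x).
Proof.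
by move=> cb cc; apply: computable_if => //; apply: computable_const.
Qed.

Lemma computable_neg (X : Type) {eX : Enc X} (b : X -> bool) :
  computable b -> computable (fun x => ~~ b x).
Proof. by move=> cb; apply: computable_if => //; apply: computable_const. Qed.

Lemma computable_iota (X : Type) {eX : Enc X} (f : X -> nat) :
  computable f -> computable (fun x => iota 0 (f x)).
Proof.
move=> cf; apply: (computable_ext (f := fun x =>
  iter (f x) (fun s => s ++ [:: size s]) [::])).
  move=> x; elim: (f x) => //= k ->.
  by rewrite size_iota -[[:: k]]/(iota (0 + k) 1) -iotaD addn1.
apply: (computable_iter (f := fun _ s => s ++ [:: size s])); comp_basic.
apply: computable_cat; comp_basic.
by apply: computable_size; comp_basic.
Qed.

Class ComputableEq (T : eqType) {eT : Enc T} :=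
  computable_eq_op : computable (fun x : T * T => x.1 == x.2).
Arguments ComputableEq T {eT}.

#[export] Instance computable_eq_nat : ComputableEq nat.
Proof.
apply: (computable_ext (f := fun x : nat * nat =>
  (x.1 - x.2 == 0) && (x.2 - x.1 == 0))).
  by case=> i j; rewrite [RHS]eqn_leq.
by apply: computable_and; apply: computable_eq0; apply: computable_subn;
  comp_basic.
Qed.

#[export] Instance computable_eq_bool : ComputableEq bool.
Proof.
apply: (computable_ext (f := fun x : bool * bool =>
  if x.1 then x.2 else ~~ x.2)); first by case=> [[] []].
by apply: computable_if; comp_basic; apply: computable_neg; comp_basic.
Qed.

Lemma computable_eq (X : Type) {eX : Enc X} (T : eqType) {eT : Enc T}
    {cT : ComputableEq T} (f g : X -> T) :
  computable f -> computable g -> computable (fun x => f x == g x).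
Proof.
by move=> cf cg; apply: (computable_comp (f := fun x => (f x, g x)) cT);
  apply: computable_pair.
Qed.

#[export] Instance computable_eq_prod (T U : eqType) {eT : Enc T} {eU : Enc U}
  {cT : ComputableEq T} {cU : ComputableEq U} : ComputableEq (T * U)%type.
Proof.
apply: (computable_ext (f := fun x : (T * U) * (T * U) =>
  (x.1.1 == x.2.1) && (x.1.2 == x.2.2))); first by case=> [[? ?] [? ?]].
by apply: computable_and; apply: computable_eq; comp_basic.
Qed.

Lemma computable_mem (X : Type) {eX : Enc X} (T : eqType) {eT : Enc T}
    {cT : ComputableEq T} (f : X -> T) (s : X -> seq T) :
  computable f -> computable s -> computable (fun x => f x \in s x).
Proof.
move=> cf cs; apply: (computable_ext (f := fun x =>
  has (fun a => f x == a) (s x))).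
  by move=> x; rewrite -has_pred1; apply: eq_has => a; rewrite /= eq_sym.
apply: (computable_has (p := fun x a => f x == a)) => //.
by apply: computable_eq; comp_basic; apply: (computable_comp cf); comp_basic.
Qed.

(** * The algorithm *)

(* One program must serve all ranks, so labels do not carry the rank [n]. *)
Notation label := (nat * bool)%type.
Notation edge := (nat * (label * nat))%type.
Notation graph := (seq edge).

Section Algorithm.
Implicit Types (G T C : graph) (a : label) (e f : edge) (p q v k n : nat).

Definition inv_label a : label := (a.1, ~~ a.2).

Definition add_edge p a q G : graph :=
  (p, (a, q)) :: (q, (inv_label a, p)) :: G.

Definition rename p q v : nat := if v == p then q else v.

Definition identify p q G : graph :=
  [seq (rename p q e.1, (e.2.1, rename p q e.2.2)) | e <- G].

(* Requiring the target of [f] to be nonzero lets [fold_step] erase that vertex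
   without ever erasing the base point 0. *)
Definition conflict e f : bool :=
  [&& e.1 == f.1, e.2.1 == f.2.1, f.2.2 != 0 & e.2.2 != f.2.2].

Definition conflicts G : seq (nat * nat) :=
  [seq (d.2.2.2, d.1.2.2)
     | d <- [seq (e, f) | e <- G, f <- G] & conflict d.1 d.2].

(* In the absence of conflicts this identifies 0 with itself. *)
Definition fold_step G : graph :=
  identify (head (0, 0) (conflicts G)).1 (head (0, 0) (conflicts G)).2 G.

(** [size G] rounds are enough: each effective one lowers the number of distinct edge targets, which
    is at most [size G]. *)
Definition fold G : graph := iter (size G) fold_step G.

(* A state [(v, (m, G))] is a graph [G] with vertices below [m] and the current
   end point [v] of the petal under construction. *)
Definition append_letter (s : nat * (nat * graph)) a : nat * (nat * graph) :=
  (s.2.1, (s.2.1.+1, add_edge s.1 a s.2.1 s.2.2)).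

Definition close_petal (s : nat * (nat * graph)) : nat * graph :=
  (s.2.1, identify s.1 0 s.2.2).

Definition add_petal (s : nat * graph) (w : seq label) : nat * graph :=
  close_petal (foldl append_letter (0, s) w).

(** Numbering starts at 1 because 0 is the base point, shared by all petals. *)
Definition bouquet (ws : seq (seq label)) : nat * graph :=
  foldl add_petal (1, [::]) ws.

Definition stallings (ws : seq (seq label)) : graph := fold (bouquet ws).2.

Definition labels n : seq label :=
  [seq (i, b) | i <- iota 0 n, b <- [:: true; false]].

Definition full n G : bool := all (fun a => (0, (a, 0)) \in G) (labels n).

(** 0 is put in by hand: the graph of the trivial subgroup has no edge. Sources suffice since edges
    come in inverse pairs. *)
Definition vertices G : seq nat := 0 :: [seq e.1 | e <- G].

Definition candidates n G : seq edge :=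
  [seq (p, x) | p <- vertices G,
                x <- [seq (a, q) | a <- labels n, q <- vertices G]].

Definition bridges n G : seq edge :=
  [seq e <- candidates n G | full n (fold (add_edge e.1 e.2.1 e.2.2 G))].

(** Vertex [v] of copy [b] is numbered [b + v.*2]. Only the edges from [C] change copy, and only
    upwards, so a path uses at most one of them. *)
Definition two_layers G C : graph :=
  [seq (e.1.*2, (e.2.1, e.2.2.*2)) | e <- G]
  ++ ([seq (e.1.*2.+1, (e.2.1, e.2.2.*2.+1)) | e <- G]
  ++ [seq (e.1.*2, (e.2.1, e.2.2.*2.+1)) | e <- C]).

(** In rank [n] the codes fill 1 to [n.*2], whence the modulus [n.*2.+1] used with them; 0 stays
    free. *)
Definition code a : nat := (a.2 + a.1.*2).+1.

(* The state [p * K + k] remembers the vertex [p] and the code [k] of the last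
   letter read, with [k = 0] before any letter is read. *)
Definition reduced_edges K T : graph :=
  [seq (d.1.1 * K + d.2, (d.1.2.1, d.1.2.2 * K + code d.1.2.1))
     | d <- [seq (e, k) | e <- T, k <- iota 0 K]
       & d.2 != code (inv_label d.1.2.1)].

Definition reduced_states K (F : seq nat) : seq nat :=
  [seq d.1 * K + d.2 | d <- [seq (p, k) | p <- F, k <- iota 0 K]].

(** 1 is the base point of the second copy. The base point 0 of the first is final only if [G] is
    full; this takes care of the empty word, which can cross no edge. *)
Definition cocycle_finals n G : seq nat :=
  1 :: (if full n G then [:: 0] else [::]).

Definition graph_automaton n G : seq nat * (seq nat * graph) :=
  ([:: 0], (reduced_states n.*2.+1 (cocycle_finals n G),
            reduced_edges n.*2.+1 (two_layers G (bridges n G)))).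

Definition cocycle_automaton (x : nat * seq (seq label)) :
    seq nat * (seq nat * graph) :=
  graph_automaton x.1 (stallings x.2).

End Algorithm.

Lemma computable_double (X : Type) {eX : Enc X} (m : X -> nat) :
  computable m -> computable (fun x => (m x).*2).
Proof.
move=> cm; apply: (computable_ext (f := fun x => m x + m x)).
  by move=> x; rewrite addnn.
exact: computable_add.
Qed.

Lemma computable_nat_of_bool (X : Type) {eX : Enc X} (b : X -> bool) :
  computable b -> computable (fun x => b x : nat).
Proof.
move=> cb; apply: (computable_ext (f := fun x => if b x then 1 else 0)).
  by move=> x; case: (b x).
by apply: computable_if; comp_basic.
Qed.

Ltac comp_tac :=
  first
  [ assumption
  | lazymatch goal with
    | |- computable (fun _ => ?b) => exact: computable_const
    | |- computable (fun x => x) => exact: computable_id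
    | H : computable ?h |- computable (fun _ => ?h _) =>
        apply: (computable_comp H); comp_tac
    | |- computable fst => exact: (computable_fst computable_id)
    | |- computable snd => exact: (computable_snd computable_id)
    | |- computable (fun _ => fst _) => apply: computable_fst; comp_tac
    | |- computable (fun _ => snd _) => apply: computable_snd; comp_tac
    | |- computable (fun _ => (_, _)) => apply: computable_pair; comp_tac
    | |- computable (fun _ => _ :: _) => apply: computable_cons; comp_tac
    | |- computable (fun _ => S _) => apply: computable_succ; comp_tac
    | |- computable (fun _ => _ ++ _) => apply: computable_cat; comp_tac
    | |- computable (fun _ => nat_of_bool _) =>
        apply: computable_nat_of_bool; comp_tac
    | |- computable (fun _ => double _) => apply: computable_double; comp_tac
    | |- computable (fun _ => _ + _) => apply: computable_add; comp_tac
    | |- computable (fun _ => _ * _) => apply: computable_mul; comp_tac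
    | |- computable (fun _ => _ && _) => apply: computable_and; comp_tac
    | |- computable (fun _ => ~~ _) => apply: computable_neg; comp_tac
    | |- computable (fun _ => _ == _) => apply: computable_eq; comp_tac
    | |- computable (fun _ => _ \in _) => apply: computable_mem; comp_tac
    | |- computable (fun _ => if _ then _ else _) => apply: computable_if; comp_tac
    | |- computable (fun _ => size _) => apply: computable_size; comp_tac
    | |- computable (fun _ => head _ _) => apply: computable_head; comp_tac
    | |- computable (fun _ => iota 0 _) => apply: computable_iota; comp_tac
    | |- computable (fun _ => [seq (_, _) | _ <- _, _ <- _]) =>
        apply: computable_allpairs; comp_tac
    | |- computable (fun _ => map _ _) => apply: computable_map; comp_tac
    | |- computable (fun _ => filter _ _) => apply: computable_filter; comp_tac
    | |- computable (fun _ => all _ _) => apply: computable_all; comp_tac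
    | |- computable (fun _ => foldl _ _ _) => apply: computable_foldl; comp_tac
    | |- computable (fun _ => iter _ _ _) => apply: computable_iter; comp_tac
    end
  | idtac ].

Lemma computable_identify (X : Type) {eX : Enc X} (p q : X -> nat)
    (G : X -> graph) :
  computable p -> computable q -> computable G ->
  computable (fun x => identify (p x) (q x) (G x)).
Proof. by move=> cp cq cG; rewrite /identify /rename; comp_tac. Qed.

Lemma computable_fold (X : Type) {eX : Enc X} (G : X -> graph) :
  computable G -> computable (fun x => fold (G x)).
Proof.
move=> cG; rewrite /fold /fold_step; apply: computable_iter; comp_tac.
by apply: computable_identify; rewrite /conflicts /conflict; comp_tac.
Qed.

Lemma computable_stallings (X : Type) {eX : Enc X} (ws : X -> seq (seq label)) :
  computable ws -> computable (fun x => stallings (ws x)).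
Proof.
move=> cws; apply: computable_fold; rewrite /bouquet.
rewrite /add_petal /close_petal /append_letter /identify /rename /add_edge.
by rewrite /inv_label; comp_tac.
Qed.

Lemma computable_cocycle_automaton : computable cocycle_automaton.
Proof.
rewrite /cocycle_automaton.
have cg : computable (fun x : nat * graph => graph_automaton x.1 x.2).
  rewrite /graph_automaton /cocycle_finals /reduced_states /reduced_edges.
  rewrite /two_layers /bridges /candidates /full /labels /vertices /code.
  rewrite /inv_label; comp_tac.
  by apply: computable_fold; rewrite /add_edge /inv_label; comp_tac.
apply: (computable_comp (f := fun x : nat * _ => (x.1, stallings x.2)) cg);
  comp_tac.
by apply: computable_stallings; comp_tac.
Qed.

(** * Folded graphs *)

Section Subgroup.
Local Open Scope group_scope.
Local Open Scope classical_set_scope.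
Variable G : groupType.
Implicit Types (H S : set G) (x y : G).

Lemma subgroupV H x : subgroup H -> H x -> H x^-1.
Proof. by move=> [H1 HV] Hx; rewrite -div1g; apply: HV. Qed.

Lemma subgroupM H x y : subgroup H -> H x -> H y -> H (x * y).
Proof.
by move=> sH Hx Hy; rewrite -[y]invgK; apply: (sH.2) => //; apply: subgroupV.
Qed.

Lemma generated_subgroup S : subgroup (generated S).
Proof.
split; first by move=> H [[]].
by move=> x y Sx Sy H HS; apply: HS.1.2; [apply: Sx | apply: Sy].
Qed.

(** Replaces the subgroup by its generators, so that only these and [x] have to be read in a
    graph. *)
Lemma generated_coc S x :
  generated (generated S `|` [set x]) = generated (S `|` [set x]).
Proof.
apply/seteqP; split; apply: smallest_sub; try exact: generated_subgroup.
- move=> y [|/= ->]; last by apply: sub_gen_smallest; right.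
  apply: smallest_sub; first exact: generated_subgroup.
  by move=> z Sz; apply: sub_gen_smallest; left.
- by move=> y [Sy|/= ->]; apply: sub_gen_smallest; [left|right] => //;
    apply: sub_gen_smallest.
Qed.
End Subgroup.

Section LabelledGraphs.
Variable n : nat.
Implicit Types (E : nat -> letter n -> nat -> Prop) (a b : letter n).
Implicit Types (w u v : seq (letter n)) (p q r : nat).

Fixpoint epath E p w q : Prop :=
  if w is a :: w' then exists2 r, E p a r & epath E r w' q else p = q.

Definition edge_symmetric E := forall p a q, E p a q -> E q (inv_letter a) p.

Definition deterministic E :=
  forall p a q q', E p a q -> E p a q' -> q = q'.

Lemma epath_cat E p u v q :
  epath E p (u ++ v) q <-> exists2 r, epath E p u r & epath E r v q.
Proof.
elim: u p => [|a u IH] p /=; first by split=> [|[r ->]]; first by exists p.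
split=> [[s pas] /IH [r sur rvq]|[r [s pas sur] rvq]].
  by exists r => //; exists s.
by exists s => //; apply/IH; exists r.
Qed.

Lemma epath_sub E E' p w q : (forall x a y, E x a y -> E' x a y) ->
  epath E p w q -> epath E' p w q.
Proof.
move=> EE'; elim: w p => //= a w IH p [r par rwq].
by exists r; [apply: EE' | apply: IH].
Qed.

Lemma epath_inv E p w q : edge_symmetric E ->
  epath E p w q -> epath E q (inv_word w) p.
Proof.
move=> sE; elim: w p => [p /= -> //|a w IH p [r par rwq]].
rewrite /inv_word /= rev_cons -cats1; apply/epath_cat.
by exists r; [apply: IH | exists p => //; apply: sE].
Qed.

(** After reading [a] from [p] to [r], the reversed edge and determinism force [inv_letter a] to
    lead from [r] back to [p]; so a cancellation keeps the end points. *)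
Lemma epath_free_reduce E p w q : edge_symmetric E -> deterministic E ->
  epath E p w q -> epath E p (free_reduce w) q.
Proof.
move=> sE dE; elim: w p => //= a w IH p [r par /IH].
case: (free_reduce w) => [|b v] /=; first by move=> rq; exists r.
case: eqVneq => [->|_] [s rbs svq]; last by exists r => //; exists s.
by rewrite (dE _ _ _ _ (sE _ _ _ par) rbs).
Qed.

Definition loops E : set (free_group n) := [set x | epath E 0 (word x) 0].

Lemma loops_subgroup E : edge_symmetric E -> deterministic E ->
  subgroup (loops E).
Proof.
move=> sE dE; split=> // x y x0 y0; apply: epath_free_reduce => //=.
by apply/epath_cat; exists 0 => //; apply: epath_inv.
Qed.

Lemma sub_loops E S : edge_symmetric E -> deterministic E ->
  (forall x, S x -> loops E x) -> forall x, generated S x -> loops E x.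
Proof.
by move=> sE dE SE; apply: smallest_sub => //; apply: loops_subgroup.
Qed.

Definition add_arc E p a q x b y :=
  [\/ E x b y, [/\ x = p, b = a & y = q]
    | [/\ x = q, b = inv_letter a & y = p]].

Lemma inv_letter_neq a : inv_letter a <> a.
Proof. by case: a => i b [] /esym/eqP; case: b. Qed.

Lemma add_arc_symmetric E p a q :
  edge_symmetric E -> edge_symmetric (add_arc E p a q).
Proof.
move=> sE x b y [/sE Eyx|[-> -> ->]|[-> -> ->]].
- exact: Or31.
- exact: Or33.
- by apply: Or32; rewrite inv_letterK.
Qed.

(** The case [p = q] is included: both new edges then leave the same vertex, but under the distinct
    letters [a] and [inv_letter a]. *)
Lemma add_arc_deterministic E p a q : deterministic E ->
  (forall r, ~ E p a r) -> (forall r, ~ E q (inv_letter a) r) ->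
  deterministic (add_arc E p a q).
Proof.
move=> dE pa qa x b y y' [Exy|[xp ba ->]|[xq ba ->]]
  [Exy'|[xp' ba' ->]|[xq' ba' ->]] //.
- exact: dE Exy Exy'.
- by case: (pa y); rewrite -xp' -ba'.
- by case: (qa y); rewrite -xq' -ba'.
- by case: (pa y'); rewrite -xp -ba.
- by case: (@inv_letter_neq a); rewrite -ba' -ba.
- by case: (qa y'); rewrite -xq -ba.
- by case: (@inv_letter_neq a); rewrite -ba -ba'.
Qed.

(* Glueing an arc reading [w] from [p] to [q], one letter at a time.  When
   [p = q] and the two ends of [w] are inverse letters, both ends fold onto the
   same new edge, and what remains is a shorter arc at its far end. *)
Lemma glue_arc k E N p q a w : size w <= k ->
  edge_symmetric E -> deterministic E ->
  (forall x b y, E x b y -> x < N) -> p < N -> q < N ->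
  reduced (a :: w) ->
  (forall r, ~ E p a r) -> (forall r, ~ E q (inv_letter (last a w)) r) ->
  exists E', [/\ edge_symmetric E', deterministic E',
    forall x b y, E x b y -> E' x b y, epath E' p (a :: w) q
    & w <> [::] -> E' p a N].
Proof.
(* The induction is on a bound for the length, since the remaining arc may be shorter by two
   letters. *)
elim: k E N p q a w => [|k IH] E N p q a [|b w] //= sw sE dE EN pN qN rw pa qa.
- exists (add_arc E p a q); split=> //.
  + exact: add_arc_symmetric.
  + exact: add_arc_deterministic.
  + by move=> *; apply: Or31.
  + by exists q => //; apply: Or32.
- exists (add_arc E p a q); split=> //.
  + exact: add_arc_symmetric.
  + exact: add_arc_deterministic.
  + by move=> *; apply: Or31.
  + by exists q => //; apply: Or32.
have Na c r : ~ E N c r by move=> /EN; rewrite ltnn.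
(* [N] is fresh: every edge of [E] starts, hence by symmetry ends, below it. *)
pose E1 := add_arc E p a N.
have sE1 : edge_symmetric E1 by apply: add_arc_symmetric.
have dE1 : deterministic E1 by apply: add_arc_deterministic.
have E1N x c y : E1 x c y -> x < N.+1.
  by case=> [/EN|[-> _ _]|[-> _ _]]; [exact: leqW | exact: leqW | exact: ltnSn].
have E1a : E1 p a N by apply: Or32.
have EE1 x c y : E x c y -> E1 x c y by move=> ?; apply: Or31.
move: rw => /andP[ba rw].
have Nb r : ~ E1 N b r.
  case=> [/Na //|[Np _ _]|[_ ba' _]]; first by move: pN; rewrite -Np ltnn.
  by move: ba; rewrite ba' eqxx.
case: (pselect (q = p /\ last b w = inv_letter a)) => [[qp la]|nqp].
- case/lastP: w sw rw qa la => [|w c] sw rw qa la.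
    (* With nothing between the two ends, [inv_letter a] would directly follow [a] in a reduced
       word. *)
    by move: ba; rewrite -la eqxx.
  rewrite last_rcons in la; subst c q.
  (* The remainder becomes a loop at [N]. The only edge of [E1] leaving [N] is labelled
     [inv_letter a], and reducedness excludes that letter at either end of the loop. *)
  case: (IH E1 N.+1 N N b w) => //.
  + by rewrite size_rcons in sw; lia.
  + by rewrite -/(path _ b w) in rw *; move: rw; rewrite rcons_path => /andP[].
  + move=> r; case=> [/Na //|[Np _ _]|[_ /(inv_inj (@inv_letterK n)) la _]].
      by move: pN; rewrite -Np ltnn.
    by move: rw; rewrite rcons_path la eqxx andbF.
  move=> E' [sE' dE' E1E' NwN _]; exists E'; split=> //.
  + by move=> x c y /EE1 /E1E'.
  + exists N; first exact: E1E'.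
    have /epath_cat : exists2 r, epath E' N (b :: w) r &
        epath E' r [:: inv_letter a] p.
      by exists N => //; exists p => //; apply/sE'/E1E'.
    by rewrite cats1.
  + by move=> _; apply: E1E'.
- case: (IH E1 N.+1 N q b w) => //; first exact: leqW.
  + move=> r; case=> [/qa //|[qp la _]|[qN' _ _]].
      by apply: nqp; split=> //; rewrite -la inv_letterK.
    by move: qN; rewrite qN' ltnn.
  move=> E' [sE' dE' E1E' NwN _]; exists E'; split=> //.
  + by move=> x c y /EE1 /E1E'.
  + by exists N => //; apply: E1E'.
  + by move=> _; apply: E1E'.
Qed.

(** Follows [w] until it gets stuck. [E] is an arbitrary relation, hence the appeal to excluded
    middle. *)
Lemma epath_prefix E p w : (exists q, epath E p w q) \/
  exists u a v r, [/\ w = u ++ a :: v, epath E p u r & forall s, ~ E r a s].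
Proof.
elim: w p => [|a w IH] p; first by left; exists p.
case: (pselect (exists r, E p a r)) => [[r par]|npa]; last first.
  by right; exists [::], a, w, p; split=> // s pas; apply: npa; exists s.
case: (IH r) => [[q rwq]|[u [b [v [s [-> ru sb]]]]]].
  by left; exists q; exists r.
by right; exists (a :: u), b, v, s; split=> //; exists r.
Qed.

End LabelledGraphs.

(** * Graphs representing a subgroup *)

Section Representation.
Variable n : nat.
Local Open Scope group_scope.
Local Open Scope classical_set_scope.
Implicit Types (G : graph) (a : letter n) (w u : seq (letter n)).
Implicit Types (x : free_group n) (H K S : set (free_group n)).
Implicit Types (phi : nat -> free_group n) (p q v : nat) (e f : edge).

Definition lab a : label := (val a.1, a.2).

Lemma lab_inj : injective lab.
Proof. by case=> i b [j c] [/val_inj -> ->]. Qed.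

Lemma labP (l : label) : l.1 < n -> exists a, l = lab a.
Proof. by case: l => i b /= ltin; exists (Ordinal ltin, b). Qed.

Definition erel G p a q : Prop := (p, (lab a, q)) \in G.

Definition symmetric_graph G : Prop :=
  forall p l q, (p, (l, q)) \in G -> (q, (inv_label l, p)) \in G.

Definition labels_below G : Prop := forall e, e \in G -> e.2.1.1 < n.

Lemma erel_symmetric G : symmetric_graph G -> edge_symmetric (erel G).
Proof. by move=> sG p a q; apply: sG. Qed.

Lemma inv_labelK : involutive inv_label.
Proof. by case=> i b; rewrite /inv_label /= negbK. Qed.

Lemma mem_add_edge p l q G v m r : (v, (m, r)) \in add_edge p l q G <->
  [\/ (v, (m, r)) \in G, [/\ v = p, m = l & r = q]
    | [/\ v = q, m = inv_label l & r = p]].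
Proof.
rewrite !inE; split.
  by case/or3P=> [/eqP[-> -> ->]|/eqP[-> -> ->]|];
    [apply: Or32|apply: Or33|apply: Or31].
by case=> [->|[-> -> ->]|[-> -> ->]]; rewrite ?eqxx ?orbT.
Qed.

Lemma symmetric_add_edge p l q G :
  symmetric_graph G -> symmetric_graph (add_edge p l q G).
Proof.
move=> sG v m r /mem_add_edge[/sG ?|[-> -> ->]|[-> -> ->]]; apply/mem_add_edge.
- exact: Or31.
- exact: Or33.
- by apply: Or32; rewrite inv_labelK.
Qed.

Lemma mem_identify p q G v l r : (v, (l, r)) \in identify p q G <->
  exists x y : nat, [/\ (x, (l, y)) \in G, v = rename p q x & r = rename p q y].
Proof.
split=> [/mapP[[x [m y]] Ge [-> -> ->]]|[x [y [Gxy -> ->]]]].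
  by exists x, y.
by apply/mapP; exists (x, (l, y)).
Qed.

Lemma symmetric_identify p q G :
  symmetric_graph G -> symmetric_graph (identify p q G).
Proof.
move=> sG v l r /mem_identify[x [y [/sG Gyx -> ->]]].
by apply/mem_identify; exists y, x.
Qed.

Lemma labels_below_identify p q G :
  labels_below G -> labels_below (identify p q G).
Proof. by move=> bG [v [l r]] /mem_identify[x [y [/bG]]]. Qed.

Lemma labels_below_add_edge p a q G :
  labels_below G -> labels_below (add_edge p (lab a) q G).
Proof.
by move=> bG [v [l r]] /mem_add_edge[/bG //|[_ -> _]|[_ -> _]] /=;
  apply: ltn_ord.
Qed.

Lemma epath_identify p q G v w r : epath (erel G) v w r ->
  epath (erel (identify p q G)) (rename p q v) w (rename p q r).
Proof.
elim: w v => [v /= -> //|a w IH v [s vas swr]].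
exists (rename p q s); last exact: IH.
by apply/mem_identify; exists v, s.
Qed.

Definition elt w : free_group n := FreeGroup (free_reduce_reduced w).

Definition gen a : free_group n := elt [:: a].

Lemma elt_word x : elt (word x) = x.
Proof. exact/val_inj/free_reduce_id/valP. Qed.

Lemma elt_cat u w : elt (u ++ w) = elt u * elt w.
Proof.
by apply: val_inj; rewrite /= free_reduce_catr free_reduce_catl.
Qed.

Lemma elt_cons a w : elt (a :: w) = gen a * elt w.
Proof. by rewrite -cat1s elt_cat. Qed.

Lemma elt_nil : elt [::] = 1.
Proof. exact: val_inj. Qed.

Lemma gen_inv a : gen (inv_letter a) = (gen a)^-1.
Proof. exact: val_inj. Qed.

Lemma generated_gens K : subgroup K -> (forall a, K (gen a)) -> forall x, K x.
Proof.
move=> sK Kg x; rewrite -(elt_word x).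
elim: (word x) => [|a w IH]; first by rewrite elt_nil; apply: sK.1.
by rewrite elt_cons; apply: subgroupM.
Qed.

(* [phi p] plays the role of the label of a path from 0 to [p]: for [phi 0 = 1],
   every element read along a closed path at 0 lies in [K]. *)
Definition potential K phi G : Prop :=
  forall p a q, erel G p a q -> K (phi p * gen a * (phi q)^-1).

Lemma potential_epath K phi G p w q : subgroup K -> potential K phi G ->
  epath (erel G) p w q -> K (phi p * elt w * (phi q)^-1).
Proof.
move=> sK pG; elim: w p => [p ->|a w IH p [r /pG Kpr /IH Krq]].
  by rewrite elt_nil mulg1 mulgV; apply: sK.1.
suff -> : phi p * elt (a :: w) * (phi q)^-1 =
  phi p * gen a * (phi r)^-1 * (phi r * elt w * (phi q)^-1).
  exact: subgroupM.
by rewrite elt_cons !mulgA mulgVK.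
Qed.

(** Only the coset of [K] containing [phi v] matters, and it is the same for [p] and [q]; so the
    same [phi] serves after the identification. *)
Lemma potential_identify K phi G p q : subgroup K -> potential K phi G ->
  K (phi p * (phi q)^-1) -> potential K phi (identify p q G).
Proof.
move=> sK pG Kpq v a r /mem_identify[x [y [/pG Kxy -> ->]]].
have Kr t : K (phi t * (phi (rename p q t))^-1).
  by rewrite /rename; case: eqVneq => [->|_] //; rewrite mulgV; apply: sK.1.
suff -> : phi (rename p q x) * gen a * (phi (rename p q y))^-1 =
    (phi x * (phi (rename p q x))^-1)^-1 * (phi x * gen a * (phi y)^-1)
    * (phi y * (phi (rename p q y))^-1).
  by apply: subgroupM => //; apply: subgroupM => //; apply: subgroupV.
by rewrite invgM invgK !mulgA mulgVK mulgVK.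
Qed.

Lemma potential_add_edge K phi G p a q : subgroup K -> potential K phi G ->
  K (phi p * gen a * (phi q)^-1) -> potential K phi (add_edge p (lab a) q G).
Proof.
move=> sK pG Kpq v b r /mem_add_edge[/pG //|[-> /lab_inj -> -> //]|].
case=> -> /(@lab_inj b (inv_letter a)) -> ->; rewrite gen_inv.
by have := subgroupV sK Kpq; rewrite !invgM invgK !mulgA.
Qed.

Lemma potential_sub K K' phi G :
  (forall x, K x -> K' x) -> potential K phi G -> potential K' phi G.
Proof. by move=> KK' pG p a q /pG /KK'. Qed.

(** The potential bounds the elements read at 0 from above by [K], the last clause from below by
    [S]. For a folded graph and [K = <S>], exactly [K] is read. *)
Definition represents K S G : Prop :=
  [/\ symmetric_graph G, labels_below G,
      exists2 phi, phi 0 = 1 & potential K phi G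
    & forall x, S x -> loops (erel G) x].

Lemma fold_stepP G :
  (conflicts G = [::] /\ fold_step G = G) \/
  exists e f, [/\ e \in G, f \in G, conflict e f
    & fold_step G = identify f.2.2 e.2.2 G].
Proof.
rewrite /fold_step; case cG: (conflicts G) => [|d s]; [left | right].
  split=> //; rewrite /identify -[RHS]map_id; apply: eq_map => -[v [l r]].
  have rid t : rename 0 0 t = t by rewrite /rename; case: eqVneq.
  by rewrite /= !rid.
have : d \in conflicts G by rewrite cG mem_head.
case/mapP=> -[e f]; rewrite mem_filter => /andP[cef /allpairsP[[e' f']]].
by move=> /= [Ge Gf [ee ff]] ->; exists e, f; rewrite ee ff in cef *.
Qed.

Lemma fold_ind (P : graph -> Prop) G :
  (forall G' e f, e \in G' -> f \in G' -> conflict e f -> P G' ->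
    P (identify f.2.2 e.2.2 G')) -> P G -> P (fold G).
Proof.
move=> Pid; rewrite /fold; elim: (size G) => //= k IH PG; move: (IH PG).
case: (fold_stepP (iter k fold_step G)) => [[_ ->] //|].
by case=> e [f [Ge Gf cef ->]]; apply: Pid.
Qed.

Lemma represents_fold K S G :
  subgroup K -> represents K S G -> represents K S (fold G).
Proof.
move=> sK; apply: fold_ind => {}G [x [l y]] [x' [l' z]] Ge Gf /=.
case/and4P=> /eqP /= xx' /eqP /= ll' z0 _ [sG bG [phi phi0 pG] SG].
subst x' l'; split.
- exact: symmetric_identify.
- exact: labels_below_identify.
- exists phi => //; apply: potential_identify => //.
  have [a la] := labP (bG _ Ge); rewrite /= in la; subst l.
  (* Dividing the elements of the two edges cancels the common source and letter and leaves
     [phi z * (phi y)^-1]. *)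
  have Ky := pG _ _ _ Ge; have := sK.2 _ _ (subgroupV sK (pG _ _ _ Gf)).
  move=> /(_ _ (subgroupV sK Ky)).
  by rewrite !invgM !invgK !mulgA mulgVK mulgVK.
(* The erased vertex [z] is not 0, so closed paths at 0 remain closed paths at 0. *)
- move=> u Su; have := epath_identify z y (SG u Su).
  by rewrite /rename eq_sym (negPf z0).
Qed.

Definition weight G := size (undup [seq e.2.2 | e <- G]).

(** The target of [f] disappears, and the target of [e] replacing it was already counted. *)
Lemma weight_identify G e f : e \in G -> f \in G -> conflict e f ->
  weight (identify f.2.2 e.2.2 G) < weight G.
Proof.
move=> Ge Gf /and4P[_ _ _ ef]; rewrite /weight /identify -map_comp /=.
set s := undup [seq e.2.2 | e <- G].
have sf : f.2.2 \in s by rewrite mem_undup; apply: map_f.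
rewrite -(prednK (_ : 0 < size s)); last by case: (s) sf.
rewrite ltnS -(size_rem sf); apply: uniq_leq_size; first exact: undup_uniq.
move=> v; rewrite mem_undup => /mapP[g Gg /= ->].
rewrite mem_rem_uniq ?undup_uniq // inE /rename mem_undup.
case: (eqVneq g.2.2 f.2.2) => [_|gf] /=; rewrite ?ef ?gf /=.
  exact: (map_f (fun e => e.2.2) Ge).
exact: (map_f (fun e => e.2.2) Gg).
Qed.

Lemma fold_conflicts G : conflicts (fold G) = [::].
Proof.
(* If conflicts persisted, each round would cost a target; after [size G] rounds no target, hence no
   edge, would be left, and the empty graph has no conflict. *)
have H k : conflicts (iter k fold_step G) = [::] \/
    weight (iter k fold_step G) + k <= weight G.
  elim: k => [|k IH] /=; first by right; rewrite addn0.
  case: (fold_stepP (iter k fold_step G)) => [[c0 ->]|[e [f [Ge Gf cef ->]]]].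
    by left.
  case: IH => [c0|IH].
    have : (f.2.2, e.2.2) \in conflicts (iter k fold_step G).
      apply/mapP; exists (e, f) => //; rewrite mem_filter cef.
      by apply/allpairsP; exists (e, f).
    by rewrite c0.
  by right; have := weight_identify Ge Gf cef; lia.
case: (H (size G)) => //; rewrite -/(fold G) => wG.
have : weight (fold G) = 0.
  have : weight G <= size G by rewrite -(size_map (fun e => e.2.2)) size_undup.
  by lia.
rewrite /weight; case: (fold G) => // e s /size0nil us.
by have := mem_undup [seq e.2.2 | e <- e :: s] e.2.2; rewrite us mem_head.
Qed.

Lemma fold_deterministic G : deterministic (erel (fold G)).
Proof.
move=> p a q q' pq pq'; apply: contra_eq (fold_conflicts G) => qq'.
suff : exists d, d \in conflicts (fold G) by case=> d; case: (conflicts _).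
have cm e f : e \in fold G -> f \in fold G -> conflict e f ->
    exists d, d \in conflicts (fold G).
  move=> Ge Gf cef; exists (f.2.2, e.2.2); apply/mapP; exists (e, f) => //.
  by rewrite mem_filter cef; apply/allpairsP; exists (e, f).
(* One of two distinct targets is nonzero and can play the erased vertex in [conflict]. *)
have [q0|q0] := eqVneq q 0.
  by apply: cm pq pq' _; rewrite /conflict /= !eqxx qq' -q0 eq_sym qq'.
by apply: cm pq' pq _; rewrite /conflict /= !eqxx q0 eq_sym qq'.
Qed.

Lemma mem_labels l : (l \in labels n) = (l.1 < n).
Proof.
case: l => i b; rewrite /labels; apply/allpairsP/idP => /= [[[j c] [/=]]|ltin].
  by rewrite mem_iota => /andP[_ ltjn] _ [-> _].
by exists (i, b); rewrite mem_iota; split=> //; case: b.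
Qed.

Lemma fullP G : full n G <-> forall a, erel G 0 a 0.
Proof.
split=> [/allP fG a|fG]; first by apply: fG; rewrite mem_labels; apply: ltn_ord.
by apply/allP=> l; rewrite mem_labels => /labP[a ->]; apply: fG.
Qed.

Lemma represents_full K S G : subgroup K -> represents K S G ->
  full n G -> forall x, K x.
Proof.
move=> sK [_ _ [phi phi0 pG] _] /fullP fG; apply: generated_gens => // a.
by have := pG _ _ _ (fG a); rewrite phi0 invg1 mulg1 mul1g.
Qed.

(** [gen a] is a one-letter word, so reading it from 0 to 0 takes a single edge, which is the loop
    asked for by [full]. *)
Lemma full_represents K S G : deterministic (erel G) -> represents K S G ->
  (forall x, generated S x) -> full n G.
Proof.
move=> dG [sG _ _ SG] allS; apply/fullP => a.
by case: (sub_loops (erel_symmetric sG) dG SG (allS (gen a))) => r par /= r0;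
  rewrite r0 in par.
Qed.

End Representation.

(** * Characterization of cocycles *)

Section Characterization.
Variable n : nat.
Local Open Scope group_scope.
Local Open Scope classical_set_scope.
Implicit Types (G : graph) (a b : letter n) (w : seq (letter n)).
Implicit Types (x : free_group n) (S : set (free_group n)).

Definition crosses G w : Prop :=
  exists w1 a w2 p q, [/\ w = w1 ++ a :: w2, epath (erel G) 0 w1 p,
    epath (erel G) q w2 0 & full n (fold (add_edge p (lab a) q G))].

Lemma erel_add_edge G p a q u b v :
  erel G u b v -> erel (add_edge p (lab a) q G) u b v.
Proof. by move=> uv; apply/mem_add_edge/Or31. Qed.

(** Up to factors in [<S>] on both sides, [x] is the element [phi p * gen a * (phi q)^-1] of the new
    edge. *)
Lemma represents_add_edge S G x w1 a w2 p q :
  represents (generated S) S G -> word x = w1 ++ a :: w2 ->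
  epath (erel G) 0 w1 p -> epath (erel G) q w2 0 ->
  represents (generated (S `|` [set x])) (S `|` [set x])
    (add_edge p (lab a) q G).
Proof.
move=> [sG bG [phi phi0 pG] SG] xw p1 p2.
have sK := generated_subgroup (S `|` [set x]).
have sH := generated_subgroup S.
have HK y : generated S y -> generated (S `|` [set x]) y.
  apply: smallest_sub => // z Sz; apply: sub_gen_smallest; by left.
split; [exact: symmetric_add_edge | exact: labels_below_add_edge | |].
- exists phi => //; apply: potential_add_edge => //.
    exact: potential_sub pG.
  have k1 := HK _ (potential_epath sH pG p1).
  have k2 := HK _ (potential_epath sH pG p2).
  have kx : generated (S `|` [set x]) x by apply: sub_gen_smallest; right.
  rewrite phi0 mul1g in k1; rewrite phi0 invg1 mulg1 in k2.
  suff -> : phi p * gen a * (phi q)^-1 =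
      (elt w1 * (phi p)^-1)^-1 * x * (phi q * elt w2)^-1.
    apply: (subgroupM sK); last exact: (subgroupV sK).
    by apply: (subgroupM sK) => //; apply: (subgroupV sK).
  rewrite -(elt_word x) xw elt_cat elt_cons !invgM invgK !mulgA.
  by rewrite mulgVK mulgK.
- move=> y [/SG y0|/= ->].
    by apply: epath_sub y0 => *; apply: erel_add_edge.
  rewrite /loops /= xw; apply/epath_cat; exists p.
    by apply: epath_sub p1 => *; apply: erel_add_edge.
  exists q; first exact/mem_add_edge/Or32.
  by apply: epath_sub p2 => *; apply: erel_add_edge.
Qed.

Lemma graph_bound G : exists N, forall u b v, erel (n := n) G u b v -> u < N.
Proof.
exists (\max_(e <- G) e.1).+1 => u b v uv; rewrite ltnS.
exact: (@leq_bigmax_seq _ G predT (fun e : edge => e.1) _ uv).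
Qed.

Lemma epath_stay E w p : deterministic E -> (forall a, E 0 a 0) ->
  epath (n := n) E 0 w p -> p = 0.
Proof.
move=> dE E0; elim: w => //= a w IH [r ar rp].
by apply: IH; rewrite -{1}(dE _ _ _ _ ar (E0 a)).
Qed.

(* If no letter of [x] can be singled out, then the part of [x] that cannot be
   read in [G] from either side has at least two letters, so glueing it to [G]
   creates a vertex other than 0 and <S, x> misses some element. *)
Lemma coc_splits S G x :
  deterministic (erel (n := n) G) -> represents (generated S) S G ->
  (forall y, generated (S `|` [set x]) y) ->
  word x = [::] \/ exists w1 a w2 p q, [/\ word x = w1 ++ a :: w2,
    epath (erel G) 0 w1 p & epath (erel G) q w2 0].
Proof.
move=> dG [/(@erel_symmetric n) sG _ _ SG] allK.
case: (epath_prefix (erel G) 0 (word x)) => [[r x0r]|].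
  (* All of [x] is readable from 0: its last letter is singled out, with the empty suffix read at
     [q = 0]. *)
  case/lastP: (word x) x0r => [|w a]; [by left | right].
  exists w, a, [::]; move: x0r; rewrite -cats1 => /epath_cat[p w0p _].
  by exists p, 0; split.
case=> [u [a [v [p [xuv u0p pa]]]]]; right.
(* The suffix [v] is read backwards from 0, through its inverse; if this succeeds, the letter [a]
   that stopped the forward reading is singled out. *)
case: (epath_prefix (erel G) 0 (inv_word v)) => [[q v0q]|].
  exists u, a, v, p, q; split=> //.
  by rewrite -(inv_wordK v); apply: epath_inv.
case=> [v1 [b [v2 [q [vv v0q qb]]]]].
have vE : v = rcons (inv_word v2) (inv_letter b) ++ inv_word v1.
  by rewrite -(inv_wordK v) vv /inv_word map_cat /= rev_cat rev_cons.
have [N0 GN0] := graph_bound G.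
set w := rcons (inv_word v2) (inv_letter b).
(* Above all sources and both attachment points; the successor also makes [N] nonzero, which the
   final contradiction uses. *)
pose N := (N0 + p + q).+1.
have rw : reduced (a :: w).
  have := valP x; rewrite /= xuv vE /reduced -cat_cons.
  by move/cat_sorted2 => [_ /cat_sorted2[]].
have GN z (c : letter n) y : erel G z c y -> z < N.
  by move=> zy; have := GN0 _ _ _ zy; rewrite /N; lia.
have pN : p < N by rewrite /N; lia.
have qN : q < N by rewrite /N; lia.
have qb' r : ~ erel G q (inv_letter (last a w)) r.
  by rewrite last_rcons inv_letterK.
have [E' [sE' dE' GE' pwq pN']] := glue_arc (leqnn _) sG dG GN pN qN rw pa qb'.
have allE y : loops E' y.
  apply: (sub_loops (S := S `|` [set x])) => // z [/SG z0|/= ->].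
    exact: epath_sub z0.
  rewrite /loops /= xuv vE -/w; apply/epath_cat; exists p.
    exact: epath_sub u0p.
  rewrite -cat_cons; apply/epath_cat; exists q => //.
  have := epath_inv sG v0q; exact: epath_sub.
(* [E'] reads every element from 0 to 0, so every letter is a loop at 0 and [u] cannot leave 0; but
   [a] leads from [p] to [N]. *)
have E0 c : E' 0 c 0.
  by case: (allE (gen c)) => r cr /= r0; rewrite r0 in cr.
have p0 : p = 0 by apply: epath_stay (epath_sub GE' u0p).
have : E' p a N by apply: pN'; rewrite /w; case: (inv_word v2).
by rewrite p0 => /(dE' _ _ _ _ (E0 a)).
Qed.

Lemma coc_joinP S G x :
  deterministic (erel (n := n) G) -> represents (generated S) S G ->
  coc_join (generated S) x <->
  (full n G /\ loops (erel G) x) \/ crosses G (word x).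
Proof.
move=> dG rG; rewrite /coc_join /= generated_coc.
have sH := generated_subgroup S; have sK := generated_subgroup (S `|` [set x]).
have HK y : generated S y -> generated (S `|` [set x]) y.
  by apply: smallest_sub => // z Sz; apply: sub_gen_smallest; left.
split=> [KT|].
  have allK y : generated (S `|` [set x]) y by rewrite KT.
  case: (coc_splits dG rG allK) => [x1|[w1 [a [w2 [p [q [xw p1 p2]]]]]]].
    (* For [x = 1] nothing is adjoined, so [G] itself must be full. *)
    left; split; last by rewrite /loops /= x1.
    apply: full_represents dG rG _ => y.
    have: generated (S `|` [set x]) `<=` generated S; last exact.
    apply: smallest_sub => // z [Sz|/= ->]; first exact: sub_gen_smallest.
    by rewrite -(elt_word x) x1 elt_nil; apply: sH.1.
  right; exists w1, a, w2, p, q; split=> //.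
  have := represents_fold sK (represents_add_edge rG xw p1 p2) => rG'.
  by apply: full_represents rG' allK; apply: fold_deterministic.
move=> alt; apply/seteqP; split=> // y _.
case: alt => [[fG _]|[w1 [a [w2 [p [q [xw p1 p2 fG]]]]]]].
  by apply: HK; apply: represents_full sH rG fG y.
have := represents_fold sK (represents_add_edge rG xw p1 p2) => rG'.
exact: represents_full sK rG' fG y.
Qed.

End Characterization.

(** * The bouquet of the generators *)

Section Bouquet.
Variable n : nat.
Local Open Scope group_scope.
Local Open Scope classical_set_scope.
Implicit Types (G : graph) (a b : letter n) (u w : seq (letter n)).
Implicit Types (x : free_group n) (H S : set (free_group n)).

Definition vertices_below (m : nat) G : Prop :=
  forall e, e \in G -> e.1 < m.

(** [u] is the part of the current petal laid so far. Its end has potential [u], which makes closing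
    the petal at 0 legitimate once the whole word lies in [H]. *)
Definition petal_inv H S u (s : nat * (nat * graph)) : Prop :=
  [/\ symmetric_graph s.2.2, labels_below n s.2.2, s.1 < s.2.1,
      vertices_below s.2.1 s.2.2
    & [/\ forall x, S x -> loops (erel s.2.2) x, epath (erel s.2.2) 0 u s.1
      & exists phi, [/\ phi 0 = 1, potential H phi s.2.2 & phi s.1 = elt u]]].

Lemma petal_inv_append H S u s a : subgroup H ->
  petal_inv H S u s -> petal_inv H S (rcons u a) (append_letter s (lab a)).
Proof.
case: s => v [m G] sH [/= sG bG vm mG [SG uv [phi [phi0 pG phiv]]]].
have m0 : 0 != m by lia.
split; rewrite /= ?ltnSn //.
- exact: symmetric_add_edge.
- exact: labels_below_add_edge.
- move=> [z [l y]] /mem_add_edge[/mG /= /leqW //|[-> _ _]|[-> _ _]] //=.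
  exact: leqW.
split.
- by move=> x /SG x0; apply: epath_sub x0 => *; apply: erel_add_edge.
- rewrite -cats1; apply/epath_cat; exists v; last first.
    by exists m => //; apply/mem_add_edge/Or32.
  by apply: epath_sub uv => *; apply: erel_add_edge.
(* The fresh vertex gets the potential for which the new edge carries the element 1. *)
exists (fun z => if z == m then phi v * gen a else phi z); split.
- by rewrite (negPf m0).
- apply: potential_add_edge => //.
    move=> z b y zy; have zm : z < m := mG _ zy.
    have ym : y < m := mG _ (sG _ _ _ zy).
    by rewrite !ltn_eqF //; apply: pG.
  by rewrite eqxx ltn_eqF // mulgV; apply: sH.1.
- by rewrite eqxx phiv -cats1 elt_cat.
Qed.

Lemma petal_inv_foldl H S u w s : subgroup H -> petal_inv H S u s ->
  petal_inv H S (u ++ w) (foldl append_letter s [seq lab a | a <- w]).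
Proof.
move=> sH; elim: w u s => [|a w IH] u s us; first by rewrite cats0.
by rewrite -cat_rcons; apply/IH/petal_inv_append.
Qed.

Lemma petal_inv_close H S x s : subgroup H -> H x ->
  petal_inv H S (word x) s ->
  petal_inv H (S `|` [set x]) [::] (0, close_petal s).
Proof.
case: s => v [m G] sH Hx [/= sG bG vm mG [SG uv [phi [phi0 pG phiv]]]].
have rn0 : rename v 0 0 = 0 by rewrite /rename; case: ifP.
split=> /=; rewrite ?(leq_trans _ vm) //.
- exact: symmetric_identify.
- exact: labels_below_identify.
- move=> [z [l y]] /mem_identify[z' [y' [/mG /= z'm -> _]]].
  by rewrite /rename; case: eqP => // _; apply: leq_trans vm.
split=> //.
  move=> y [/SG /(epath_identify v 0)|/= ->]; first by rewrite rn0.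
  by have /(epath_identify v 0) := uv; rewrite rn0 /rename eqxx.
exists phi; split=> //; last by rewrite phi0 elt_nil.
by apply: potential_identify => //; rewrite phi0 invg1 mulg1 phiv elt_word.
Qed.

Definition labelled_word x : seq label := [seq lab a | a <- word x].

Lemma petal_inv_bouquet H (gens : seq (free_group n)) : subgroup H ->
  (forall x, x \in gens -> H x) ->
  petal_inv H [set x | x \in gens] [::] (0, bouquet (map labelled_word gens)).
Proof.
move=> sH; elim/last_ind: gens => [|gens x IH] Hg.
  split=> //=; split=> //; exists (fun=> 1); split=> //; by rewrite elt_nil.
rewrite map_rcons /bouquet foldl_rcons -/(bouquet _) /add_petal.
have /IH IHg : forall y, y \in gens -> H y.
  by move=> y yg; apply: Hg; rewrite mem_rcons inE yg orbT.
have Hx : H x by apply: Hg; rewrite mem_rcons mem_head.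
have -> : [set y | y \in rcons gens x] = [set y | y \in gens] `|` [set x].
  apply/seteqP; split=> y /=; rewrite mem_rcons inE.
    by case/orP=> [/eqP ->|]; [right | left].
  by case=> [-> //|->]; rewrite ?eqxx ?orbT.
have /(petal_inv_close sH Hx) := petal_inv_foldl (word x) sH IHg.
by [].
Qed.

Lemma represents_bouquet H (gens : seq (free_group n)) : subgroup H ->
  (forall x, x \in gens -> H x) ->
  represents H [set x | x \in gens] (bouquet (map labelled_word gens)).2.
Proof.
move=> sH /(petal_inv_bouquet sH)[/= sG bG _ _ [SG _ [phi [phi0 pG _]]]].
by split=> //; exists phi.
Qed.

End Bouquet.

(** * The automaton *)

Section Automaton.
Variable n : nat.
Local Open Scope classical_set_scope.
Implicit Types (G T C : graph) (a : letter n) (w : seq (letter n)).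
Implicit Types (p q k K : nat) (b c : bool).

Lemma erel_two_layers G C b p a v : erel (two_layers G C) (b + p.*2) a v <->
  (exists2 q, v = b + q.*2 & erel G p a q) \/
  (b = false /\ exists2 q, v = q.*2.+1 & erel C p a q).
Proof.
have inj c q c' q' : c + q.*2 = c' + q'.*2 -> c = c' /\ q = q'.
  by case: c; case: c'; lia.
rewrite /erel /two_layers !mem_cat; split.
  case/or3P=> /mapP[[x [l y]] xy /= [bp la ->]].
  - have [b0 px] := inj b p false x bp; rewrite b0 px la; left.
    by exists y.
  - have [b1 px] := inj b p true x bp; rewrite b1 px la; left.
    by exists y.
  - have [b0 px] := inj b p false x bp; rewrite b0 px la; right.
    by split=> //; exists y.
case=> [[q -> pq]|[-> [q -> pq]]]; apply/or3P.
- case: b; [apply: Or32 | apply: Or31]; apply/mapP;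
    by exists (p, (lab a, q)).
- by apply: Or33; apply/mapP; exists (p, (lab a, q)).
Qed.

Lemma epath_layer G C b p w q :
  epath (erel G) p w q -> epath (erel (two_layers G C)) (b + p.*2) w (b + q.*2).
Proof.
elim: w p => [p -> //|a w IH p [r pr /IH rq]].
by exists (b + r.*2) => //; apply/erel_two_layers; left; exists r.
Qed.

Lemma epath_two_layers G C b p w c q :
  epath (erel (two_layers G C)) (b + p.*2) w (c + q.*2) ->
  (b = c /\ epath (erel G) p w q) \/
  [/\ b = false, c = true & exists w1 a w2 r s, [/\ w = w1 ++ a :: w2,
    epath (erel G) p w1 r, erel C r a s & epath (erel G) s w2 q]].
Proof.
elim: w b p => [|a w IH] b p /=.
  by move=> bp; left; case: b bp; case: c => bp; split=> //; lia.
case=> v /erel_two_layers[[r -> pr] /IH|[-> [r -> pr] /(IH true)]].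
  case=> [[-> rq]|[-> -> [w1 [d [w2 [s [t [-> rs st tq]]]]]]]].
    by left; split=> //; exists r.
  right; split=> //; exists (a :: w1), d, w2, s, t; split=> //.
  by exists r.
by case=> [[<- rq]|[]//]; right; split=> //; exists [::], a, w, p, r.
Qed.

Lemma mem_candidates G p a q : ((p, (lab a, q)) \in candidates n G) =
  (p \in vertices G) && (q \in vertices G).
Proof.
apply/allpairsP/andP=> [[[r x] [rV /allpairsP[[l s] [_ sV xE]]]]|[pV qV]].
  by rewrite xE => -[-> _ ->].
exists (p, (lab a, q)); split=> //; apply/allpairsP.
by exists (lab a, q); split=> //; rewrite mem_labels; apply: ltn_ord.
Qed.

Lemma epath_vertex G w p : epath (n := n) (erel G) p w 0 -> p \in vertices G.
Proof.
case: w => [-> |a w [r pr _]]; first exact: mem_head.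
by rewrite inE (map_f (fun e : edge => e.1) pr) orbT.
Qed.

Lemma crossesP G w : symmetric_graph G ->
  crosses G w <-> epath (erel (two_layers G (bridges n G))) 0 w 1.
Proof.
move=> sG; split.
  case=> [w1 [a [w2 [p [q [-> p1 p2 fG]]]]]]; apply/epath_cat.
  exists p.*2; first exact: (epath_layer _ false p1).
  exists q.*2.+1; last exact: (epath_layer _ true p2).
  apply/(@erel_two_layers _ _ false p); right; split=> //; exists q => //.
  (* Restricting bridges to [vertices G] loses nothing: [p] and [q] are both joined to 0 by a path
     in [G]. *)
  rewrite /erel mem_filter fG mem_candidates (epath_vertex p2) /=.
  by rewrite (epath_vertex (epath_inv (erel_symmetric sG) p1)).
move/(@epath_two_layers _ _ false 0 _ true 0) => [[//]|[_ _]].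
case=> [w1 [a [w2 [p [q [-> p1 + p2]]]]]].
by rewrite /erel mem_filter => /andP[fG _]; exists w1, a, w2, p, q.
Qed.

Lemma finalsP G w : symmetric_graph G ->
  (exists2 f, f \in cocycle_finals n G &
    epath (erel (two_layers G (bridges n G))) 0 w f) <->
  (full n G /\ epath (erel G) 0 w 0) \/ crosses G w.
Proof.
move=> sG; rewrite /cocycle_finals; split.
  case=> f; rewrite inE => /orP[/eqP ->|]; first by move/(crossesP _ sG); right.
  case: ifP => // fG; rewrite inE => /eqP ->.
  by move/(@epath_two_layers _ _ false 0 _ false 0) => [[_ ?]|[]//]; left.
case=> [[fG w0]|/(crossesP _ sG) w1]; last by exists 1.
by exists 0; [rewrite fG | apply: (@epath_layer _ _ false 0 _ 0)].
Qed.

Lemma code_inj : injective code.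
Proof.
by case=> i b [j c]; rewrite /code /= => ij; congr pair; move: ij;
  case: b; case: c; lia.
Qed.

Lemma code_lab a : code (lab a) < n.*2.+1.
Proof.
rewrite /code /=; have := ltn_ord a.1; case: a.2 => /=; lia.
Qed.

Lemma state_inj K p k q l : k < K -> l < K ->
  p * K + k = q * K + l -> p = q /\ k = l.
Proof.
move=> kK lK pq; have K0 : 0 < K by lia.
have pE : p = q.
  by have := congr1 (divn^~ K) pq; rewrite !divnMDl // !divn_small // !addn0.
by split=> //; apply/eqP; rewrite -(eqn_add2l (p * K)) pq pE.
Qed.

Lemma erel_reduced_edges T p k a s : k < n.*2.+1 ->
  erel (reduced_edges n.*2.+1 T) (p * n.*2.+1 + k) a s <->
  exists q, [/\ erel T p a q, k != code (lab (inv_letter a))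
    & s = q * n.*2.+1 + code (lab a)].
Proof.
move=> kK; split.
  case/mapP=> -[[p' [l q]] k']; rewrite mem_filter.
  case/andP=> kl /allpairsP[[e k''] [Te]].
  rewrite mem_iota add0n => /andP[_ k'K] /= [ee kk]; subst e k''.
  case=> /(state_inj kK k'K)[pp kk] la ->.
  by rewrite /= in kk; subst p' k l; exists q.
case=> q [pq ka ->]; apply/mapP; exists ((p, (lab a, q)), k) => //.
rewrite mem_filter ka; apply/allpairsP; exists ((p, (lab a, q)), k).
by rewrite mem_iota.
Qed.

(** [k] is the code of the preceding letter; 0 is no code and imposes nothing. *)
Definition may_follow k w : bool :=
  if w is a :: w' then (k != code (lab (inv_letter a))) && reduced w else true.

Lemma may_follow_cons k a w : may_follow k (a :: w) =
  (k != code (lab (inv_letter a))) && may_follow (code (lab a)) w.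
Proof.
rewrite /may_follow; case: w => [|b w] //; congr andb.
rewrite /reduced /=; congr andb.
rewrite (inj_eq code_inj) (inj_eq (@lab_inj n)) eq_sym.
by rewrite (can2_eq (@inv_letterK n) (@inv_letterK n)).
Qed.

(** Final states carry every possible code, so reducedness is enforced by the transitions alone. *)
Lemma epath_reduced_edges T (F : seq nat) p k w : k < n.*2.+1 ->
  (exists2 s, s \in reduced_states n.*2.+1 F &
    epath (erel (reduced_edges n.*2.+1 T)) (p * n.*2.+1 + k) w s) <->
  may_follow k w /\ exists2 f, f \in F & epath (erel T) p w f.
Proof.
elim: w p k => [|a w IH] p k kK.
  split=> /= [[s sF]|[_ [f fF pf]]].
    case/mapP: sF => -[f k'] /allpairsP[[g l] [gF]].
    rewrite mem_iota add0n => /andP[/= _ lK] [-> ->] ->.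
    by case/(state_inj kK lK) => -> _; split=> //; exists g.
  rewrite pf.
  exists (f * n.*2.+1 + k) => //; apply/mapP; exists (f, k) => //.
  by apply/allpairsP; exists (f, k); rewrite mem_iota.
rewrite may_follow_cons; split.
  case=> s sF [t /(erel_reduced_edges _ _ _ _ kK)[q [pq ka ->]] tw].
  have [] := (IH q _ (code_lab a)).1; first by exists s.
  by rewrite ka => -> [f fF qf]; split=> //; exists f => //; exists q.
case=> /andP[ka kw] [f fF [q pq qf]].
have [|s sF sw] := (IH q _ (code_lab a)).2; first by split=> //; exists f.
exists s => //; exists (q * n.*2.+1 + code (lab a)) => //.
by apply/(erel_reduced_edges _ _ _ _ kK); exists q.
Qed.

Lemma may_follow0 w : may_follow 0 w = reduced w.
Proof. by case: w. Qed.

Lemma labels_below_automaton G : labels_below n G ->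
  labels_below n (graph_automaton n G).2.2.
Proof.
move=> bG e /mapP[[f k]]; rewrite mem_filter => /andP[_ /allpairsP[[g l] /=]].
case=> gT _ [-> _] -> /= {f k l}; move: gT; rewrite /two_layers !mem_cat.
case/or3P=> /mapP[[p [m q]] mem -> /=]; try exact: (bG _ mem).
move: mem; rewrite mem_filter => /andP[_ /allpairsP[[r x] [_]]].
by case/allpairsP=> -[l s] []; rewrite mem_labels => ? _ -> [_ -> _].
Qed.

Definition untyped_edge (e : nat * letter n * nat) : edge :=
  (e.1.1, (lab e.1.2, e.2)).

(** Brings the output of the rank-free program back to the alphabet [letter n]. *)
Lemma labels_below_typed G : labels_below n G ->
  exists es, map untyped_edge es = G.
Proof.
elim: G => [|[p [l q]] G IH] bG; first by exists [::].
case: IH => [e Ge|es <-]; first by apply: bG; rewrite inE Ge orbT.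
have [a la] := labP (bG _ (mem_head _ _)); rewrite /= in la.
by exists ((p, a, q) :: es); rewrite la.
Qed.

Lemma run_epath (M : automaton (letter n)) p w q :
  run M p w q <-> epath (erel (map untyped_edge (edges M))) p w q.
Proof.
elim: w p => [|a w IH] p /=; first by split=> /eqP.
split.
  case/hasP=> -[[p' a'] r] Me /and3P[/= /eqP <- /eqP <- /IH rq].
  by exists r => //; apply/mapP; exists (p', a', r).
case=> r /mapP[[[p' a'] r'] Me] /eqP.
rewrite xpair_eqE xpair_eqE (inj_eq (@lab_inj n)) /=.
case/and3P=> /eqP -> /eqP -> /eqP -> rq.
by apply/hasP; exists (p', a', r') => //=; rewrite !eqxx; apply/IH.
Qed.

Lemma acceptsP (M : automaton (letter n)) w : accepts M w <->
  exists p q, [/\ p \in initial M, q \in final M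
    & epath (erel (map untyped_edge (edges M))) p w q].
Proof.
split=> [/hasP[p pI /hasP[q qF /run_epath pq]]|[p [q [pI qF /run_epath pq]]]].
  by exists p, q.
by apply/hasP; exists p => //; apply/hasP; exists q.
Qed.

Lemma enc_seq_map (A B : Type) (f : A -> B) (t : B -> tree) s :
  enc_seq t (map f s) = enc_seq (t \o f) s.
Proof. by elim: s => //= x s ->. Qed.

(** Trees do not record the bound on ordinals, so typed and untyped data have literally the same
    encoding. *)
Lemma enc_automatonE (M : automaton (letter n)) :
  enc_automaton M =
  enc (initial M, (final M, map untyped_edge (edges M))).
Proof.
by rewrite /enc /= /enc_prod_inst /enc /= /enc_seq_inst enc_seq_map.
Qed.

Lemma enc_generatorsE (gens : seq (free_group n)) :
  enc_generators gens = enc (n, map (@labelled_word n) gens).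
Proof.
rewrite /enc_generators /enc /= /enc_prod_inst /= /enc /= /enc_seq_inst.
rewrite enc_seq_map; congr Cons; elim: gens => //= x gens ->; congr Cons.
by rewrite /enc /enc_seq_inst /= enc_seq_map.
Qed.

Lemma cocycle_automaton_correct (gens : seq (free_group n)) :
  exists M : automaton (letter n),
    enc_automaton M =
      enc (cocycle_automaton (n, map (@labelled_word n) gens)) /\
    recognizes M (language (coc_join (generated [set x | x \in gens]))).
Proof.
rewrite /cocycle_automaton /=.
set S := [set x | x \in gens]; set G := stallings _.
have sH := generated_subgroup S.
have rG : represents (generated S) S G.
  apply: represents_fold => //; apply: represents_bouquet => // x xg.
  exact: sub_gen_smallest.
have dG : deterministic (erel (n := n) G) by apply: fold_deterministic.
have [sG bG _ _] := rG.
have [es esE] := labels_below_typed (labels_below_automaton bG).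
exists (Automaton (graph_automaton n G).1 (graph_automaton n G).2.1 es).
rewrite enc_automatonE /= esE; split; first by [].
apply/seteqP.
have acc w : accepts (Automaton (graph_automaton n G).1
      (graph_automaton n G).2.1 es) w <->
    reduced w /\ ((full n G /\ epath (erel G) 0 w 0) \/ crosses G w).
  (* The initial state 0 is vertex 0 with code 0, before any letter is read. *)
  rewrite -may_follow0 -finalsP // -(@epath_reduced_edges _ _ 0 0) //.
  split=> [/acceptsP[p [q]]|[q qF pq]].
    by rewrite /= esE inE => -[/eqP -> qF pq]; exists q.
  by apply/acceptsP; exists 0, q; rewrite /= esE inE.
split=> w /=.
  case=> x /(coc_joinP x dG rG) cx <-; apply/acc.
  by split=> //; apply: valP x.
move=> /acc[rw cw]; exists (FreeGroup rw) => //.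
by apply/(coc_joinP _ dG rG).
Qed.

End Automaton.

Local Open Scope classical_set_scope.

Theorem lemma5p7 :
  (forall (n : nat) (H : set (free_group n)),
     subgroup H -> finitely_generated H -> rational (coc_join H)) /\
  (exists c : cmd,
     forall (n : nat) (gens : seq (free_group n)),
       exists M : automaton (letter n),
         exec c (enc_generators gens) (enc_automaton M) /\
         recognizes M (language (coc_join (generated [set x | x \in gens])))).
Proof.
split=> [n H _ [S /finite_seqP[gens ->] ->]|].
  by have [M [_ rM]] := cocycle_automaton_correct gens; exists M.
have [c cP] := computable_cocycle_automaton.
exists c => n gens; have [M [eM rM]] := cocycle_automaton_correct gens.
by exists M; split=> //; rewrite enc_generatorsE eM.
Qed.
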